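(* Let $P$ and $Q$ be distributions on $\mathcal{X}\times\{0,1\}$, and let $(X_1,Y_1),\dots,(X_m,Y_m)\stackrel{iid}{\sim}P$ and $X_{m+1},\dots,X_{m+n}\stackrel{iid}{\sim}Q_X$ be independent samples. Assume (A), (B), (C) below hold, and that $\widehat\eta_P$ (computed from $(X_1,Y_1),\dots,(X_m,Y_m)$) is a $(\delta_m,\tau_m)$-accurate estimator of $\eta_P$. Let $\widehat t_{P,Q,\alpha}$ be the $\lfloor n(1-\alpha)\rfloor$-th smallest value among $\widehat\eta_P(X_{m+1}),\dots,\widehat\eta_P(X_{m+n})$ and $\widehat G_{P,Q,\alpha}=\{x:\widehat\eta_P(x)\ge\widehat t_{P,Q,\alpha}\}$. Then for each $r>0$ there exists a positive constant $c$ such that, for $m$ and $n$ large enough, with probability at least $1-\tau_m-n^{-r}$ with respect to the draw of the two samples, $$Q_X(\widehat G_{P,Q,\alpha}\,\Delta\,G_{P,Q,\alpha})\le c\Big\{\delta_m^\kappa+\Big(\frac{\log n}{n}\Big)^{1/2}\Big\}.$$ Assumptions: (A) there exists $t_{P,Q,\alpha}\in(0,1]$ with $Q_X(\{x:\eta_P(x)\ge t_{P,Q,\alpha}\})=\alpha$; (B) there are positive constants $\delta_0,b_1,b_2,\kappa$ such that for all $\delta\in[-\delta_0,\delta_0]$, $b_1|\delta|^\kappa\le|F_{P,Q}(t_{P,Q,\alpha}+\delta)-F_{P,Q}(t_{P,Q,\alpha})|\le b_2|\delta|^\kappa$; (C) the support of $Q_X$ is contained in the support of $P_X$.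
   Context: $\mathcal{X}$ is a compact subset of $\mathbb{R}^d$. For a distribution $P$ of $(X,Y)\in\mathcal{X}\times\{0,1\}$, $P_X$ is the marginal of $X$ and $\eta_P(x)=P(Y=1\mid X=x)$; similarly $Q_X$, $\eta_Q$ for $Q$. All class-conditional distributions have densities w.r.t. a common dominating measure. $\alpha\in(0,1)$ is fixed. $F_{P,Q}(t)=Q_X(\{x:\eta_P(x)\le t\})$. Under (A) and (B), $t_{P,Q,\alpha}$ is unique and $G_{P,Q,\alpha}=\{x:\eta_P(x)\ge t_{P,Q,\alpha}\}$. For sequences of positive reals $\delta_m,\tau_m\to0$, an estimator $\widehat\eta_P$ of $\eta_P$ based on $m$ iid samples from $P$ is $(\delta_m,\tau_m)$-accurate if $P^m(\|\widehat\eta_P-\eta_P\|_\infty\ge\delta_m)\le\tau_m$ for all sufficiently large $m$, where $P^m$ is the product measure. $G\Delta G'$ denotes symmetric difference. *)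

(* Defs.v *)
From HB Require Import structures.
From mathcomp Require Import all_boot all_order all_algebra.
From mathcomp Require Import all_classical all_reals all_analysis.
Import Order.TTheory GRing.Theory Num.Theory.
Import numFieldTopology.Exports numFieldNormedType.Exports.

Set Implicit Arguments.
Unset Strict Implicit.
Unset Printing Implicit Defensive.

Local Open Scope classical_set_scope.
Local Open Scope ring_scope.

(* The feature space R^d is 'rV[R]_d (with its product/norm topology);
   we equip it with its Borel sigma-algebra (generated by the open sets). *)
Section borel_rV.
Variables (R : realType) (d : nat).
HB.instance Definition _ := @isMeasurable.Build default_measure_display 'rV[R]_d
  <<s open >> (@sigma_algebra0 _ setT open) (@sigma_algebraC _ open)
  (@sigma_algebra_bigcup _ setT open).
End borel_rV.

Section defs.
Variables (R : realType) (d : nat).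
Local Notation Rd := 'rV[R]_d.

Definition msupport (mu : set Rd -> \bar R) : set Rd :=
  [set x | forall U : set Rd, open U -> U x -> (0 < mu U)%E].

Definition Fcdf (QX : set Rd -> \bar R) (K : set Rd) (eta : Rd -> R) (t : R) : R :=
  fine (QX [set x | K x /\ eta x <= t]).

Definition upper_set (K : set Rd) (eta : Rd -> R) (t : R) : set Rd :=
  [set x | K x /\ t <= eta x].

Definition kth_smallest (k : nat) (s : seq R) : R := nth 0 (sort <=%R s) k.-1.

Definition t_hat (alpha : R) (etahat : Rd -> R) (xs : seq Rd) : R :=
  kth_smallest (Num.truncn ((size xs)%:R * (1 - alpha))) [seq etahat x | x <- xs].

Section sampling.
Variables (dO : measure_display) (Omega : measurableType dO).

Definition lab_sample (Xs : nat -> Omega -> Rd) (Ys : nat -> Omega -> bool)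
  (m : nat) (w : Omega) : seq (Rd * bool) :=
  [seq (Xs i w, Ys i w) | i <- iota 0 m].

Definition unlab_sample (Xt : nat -> Omega -> Rd) (n : nat) (w : Omega) : seq Rd :=
  [seq Xt j w | j <- iota 0 n].

Definition sample_sigma (Xs : nat -> Omega -> Rd) (Ys : nat -> Omega -> bool)
  (Xt : nat -> Omega -> Rd) (k : nat + nat) : set (set Omega) :=
  match k with
  | inl i => [set E | exists2 B : set (Rd * bool), measurable B &
                E = (fun w => (Xs i w, Ys i w)) @^-1` B]
  | inr j => [set E | exists2 B : set Rd, measurable B & E = Xt j @^-1` B]
  end.

Definition mutually_independent (Pr : probability Omega R) (I : eqType)
  (F : I -> set (set Omega)) : Prop :=
  forall (J : seq I) (E : I -> set Omega), uniq J ->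
    (forall k, k \in J -> F k (E k)) ->
    fine (Pr (\bigcap_(k in [set k | k \in J]) E k)) =
      \prod_(k <- J) fine (Pr (E k)).

(* "S has probability at least p" (inner probability) *)
Definition prob_atleast (Pr : probability Omega R) (S : set Omega) (p : R) : Prop :=
  exists E, [/\ measurable E, E `<=` S & (p%:E <= Pr E)%E].

(* "S has probability at most p" (outer probability) *)
Definition prob_atmost (Pr : probability Omega R) (S : set Omega) (p : R) : Prop :=
  exists E, [/\ measurable E, S `<=` E & (Pr E <= p%:E)%E].

Definition accurate (Pr : probability Omega R) (Xs : nat -> Omega -> Rd)
  (Ys : nat -> Omega -> bool) (K : set Rd) (eta : Rd -> R)
  (est : seq (Rd * bool) -> Rd -> R) (delta tau : nat -> R) : Prop :=
  exists M, forall m, (M <= m)%N ->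
    prob_atmost Pr
      [set w | ((delta m)%:E <=
         ereal_sup [set (`|est (lab_sample Xs Ys m w) x - eta x|)%:E | x in K])%E]
      (tau m).

End sampling.
End defs.

(* Main.v *)
(* No conditioning on the labelled sample is needed: off an event of probability
   tau_m the estimator is uniformly delta_m-close to eta_P on K, and this alone
   moves each order statistic by at most delta_m.  With
   b1 s^kappa = eps = 8 (r + 1) sqrt (ln n / n), assumption (B) puts F (t + s) and
   F (t - s) at distance at least eps from 1 - alpha, so by a Chernoff bound the
   empirical quantile of eta_P lies in [t - s, t + s] up to probability n^-r.  Then the
   symmetric difference lies in the band |eta_P - t| <= s + 2 delta_m, whose
   mass is at most 2 b2 (s + 2 delta_m)^kappa by (B) again. *)
Require Import Defs.
From HB Require Import structures.
From mathcomp Require Import all_boot all_order all_algebra.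
From mathcomp Require Import all_classical all_reals all_analysis.
From mathcomp Require Import ring lra zify.
Import Order.TTheory GRing.Theory Num.Theory.
Import numFieldTopology.Exports numFieldNormedType.Exports.
Local Open Scope classical_set_scope.
Local Open Scope ring_scope.

(** * Union bound and complement for outer probability *)

Section outer_probability.
Context (R : realType) (d : measure_display) (T : measurableType d).
Context (Pr : probability T R).
Implicit Types (S : set T) (p : R).

Lemma prob_atmost_sub S1 S2 p1 p2 : S1 `<=` S2 -> p2 <= p1 ->
  prob_atmost Pr S2 p2 -> prob_atmost Pr S1 p1.
Proof.
move=> S12 p21 [E [mE S2E PE]]; exists E; split => //; first exact: subset_trans S2E.
by rewrite (le_trans PE)// lee_fin.
Qed.

Lemma prob_atmost0 : prob_atmost Pr set0 0.
Proof. by exists set0; split => //; rewrite measure0. Qed.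

Lemma prob_atmostU S1 S2 p1 p2 : prob_atmost Pr S1 p1 ->
  prob_atmost Pr S2 p2 -> prob_atmost Pr (S1 `|` S2) (p1 + p2).
Proof.
move=> [E1 [mE1 S1E PE1]] [E2 [mE2 S2E PE2]]; exists (E1 `|` E2); split.
- exact: measurableU.
- exact: setUSS.
- by rewrite (le_trans (measureU2 Pr mE1 mE2))// EFinD leeD.
Qed.

Lemma prob_atmost_bigsetU (I : finType) (P : pred I) (S : I -> set T) (p : I -> R) :
  (forall i, P i -> prob_atmost Pr (S i) (p i)) ->
  prob_atmost Pr (\big[setU/set0]_(i | P i) S i) (\sum_(i | P i) p i).
Proof.
move=> Sp; apply: (big_rec2 (fun S p => prob_atmost Pr S p)) => [|i p' S' Pi].
  exact: prob_atmost0.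
exact/prob_atmostU/Sp.
Qed.

Lemma prob_atmost_setC S p : prob_atmost Pr S p -> prob_atleast Pr (~` S) (1 - p).
Proof.
move=> [E [mE SE PE]]; exists (~` E); split; first exact: measurableC.
  exact: subsetC.
by rewrite probability_setC// EFinB leeB.
Qed.

End outer_probability.

(** * A Chernoff bound for the number of occurring events *)

Section chernoff.
Context (R : realType).

(** From exp(-x) >= 1 - x one gets exp(x) (1 - x) <= 1, while (1 + x + 2 x^2)(1 - x) = 1 + x^2 (1 -
    2 x) >= 1 on this interval. *)
Lemma expR_le_quadratic (x : R) : 0 <= x <= 2^-1 -> expR x <= 1 + x + 2 * x ^+ 2.
Proof.
move=> /andP[x0 x1].
have := expR_ge1Dx (- x); rewrite expRN => h.
have e0 := expR_gt0 x.
have h1 : expR x * (1 - x) <= 1.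
  by rewrite mulrC -ler_pdivlMr// mul1r.
have h2 : 1 <= (1 + x + 2 * x ^+ 2) * (1 - x).
  have : 0 <= x ^+ 2 * (1 - 2 * x) by apply: mulr_ge0; [exact: sqr_ge0|lra].
  lra.
by rewrite -(@ler_pM2r _ (1 - x)); [lra|lra].
Qed.

Context (d : measure_display) (T : measurableType d) (Pr : probability T R).

(* The event splits into the 2^n patterns J of occurring A_i; bounding the
   indicator of [a <= #|J|] by [expR (l (#|J| - a))] makes the sum over
   patterns factor as [expR (- l a) * (q expR l + 1 - q) ^+ n]. *)
Lemma chernoff_count (n : nat) (A : 'I_n -> set T) (q eps : R) (a : nat) :
  (forall J : {set 'I_n}, prob_atmost Pr [set w | [set i | w \in A i]%SET = J]
     (\prod_i (if i \in J then q else 1 - q))) ->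
  0 <= q <= 1 -> 0 <= eps <= 2 -> n%:R * (q + eps) <= a%:R ->
  prob_atmost Pr [set w | (a <= #|[set i | w \in A i]%SET|)%N]
    (expR (- (n%:R * eps ^+ 2 / 8))).
Proof.
move=> patt /andP[q0 q1] /andP[e0 e2] na.
apply: (@prob_atmost_sub _ _ _ _ _ _ _ _ _ _
  (@prob_atmost_bigsetU _ _ _ Pr _ (fun J : {set 'I_n} => a <= #|J|)%N _ _
    (fun J _ => patt J))).
  by move=> w /= aw; rewrite (bigD1 [set i | w \in A i]%SET)//=; left.
(* The final exponent is at most n (2 l^2 - l eps), which is minimal at l = eps/4 with value - n
   eps^2 / 8. As eps <= 2, this gives l <= 1/2, the range of the quadratic bound on the
   exponential. *)
set l := eps / 4.
have l0 : 0 <= l by rewrite /l; lra.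
apply: (@le_trans _ _ (\sum_(J in {set 'I_n})
   expR (- (l * a%:R)) * \prod_i (if i \in J then q * expR l else 1 - q))).
  rewrite big_mkcond; apply: ler_sum => J _.
  have -> : \prod_i (if i \in J then q * expR l else 1 - q) =
      expR (l * #|J|%:R) * \prod_i (if i \in J then q else 1 - q).
    rewrite expRM_natr -prodr_const [\prod_(_ in J) _]big_mkcond -big_split/=.
    by apply: eq_bigr => i _; case: ifP; rewrite ?mul1r// mulrC.
  have p0 : 0 <= \prod_i (if i \in J then q else 1 - q).
    by apply: prodr_ge0 => i _; case: ifP => _; lra.
  rewrite mulrA -expRD; case: ifP => aJ; last by rewrite mulr_ge0// expR_ge0.
  rewrite ler_peMl// -[leLHS]expR0 ler_expR addrC subr_ge0 ler_wpM2l//.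
  by rewrite ler_nat.
rewrite -mulr_sumr -(bigA_distr _ _ (fun _ => q * expR l) (fun _ => 1 - q)).
rewrite prodr_const card_ord.
have h : q * expR l + (1 - q) <= expR (q * l + 2 * l ^+ 2).
  apply: le_trans (expR_ge1Dx _).
  have : q * expR l <= q * (1 + l + 2 * l ^+ 2).
    by apply: ler_wpM2l => //; apply: expR_le_quadratic; rewrite /l; lra.
  have : 0 <= (1 - q) * l ^+ 2 by apply: mulr_ge0; [lra|exact: sqr_ge0].
  lra.
have h0 : 0 <= q * expR l + (1 - q).
  by rewrite addr_ge0 ?mulr_ge0 ?expR_ge0//; lra.
apply: (@le_trans _ _ (expR (- (l * a%:R)) * expR (q * l + 2 * l ^+ 2) ^+ n)).
  by rewrite ler_wpM2l ?expR_ge0// lerXn2r// nnegrE expR_ge0.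
rewrite -expRM_natr -expRD ler_expR.
have : l * (n%:R * (q + eps)) <= l * a%:R by exact: ler_wpM2l.
rewrite /l; lra.
Qed.
End chernoff.

(** * Counts and order statistics of a list *)

Lemma count_map_iota (T : Type) (X : nat -> T) (P : pred T) (n : nat) :
  count P [seq X j | j <- iota 0 n] = #|[set i : 'I_n | P (X i)]%SET|.
Proof.
rewrite count_map -sum1_count -sum1_card big_mkcond/= [RHS]big_mkcond/=.
have -> : iota 0 n = index_iota 0 n by rewrite /index_iota subn0.
rewrite big_mkord.
by apply: eq_bigr => i _; rewrite inE.
Qed.

Section order_statistic.
Context (R : realType).
Implicit Types (s : seq R) (c : R).

(** Rank k is read at index [k.-1], so rank 0 would also return the first entry; hence [0 < k] here.
    In both bounds k is at most the size of the list, so [nth] never returns its default 0. *)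
Lemma kth_smallest_le k s c : (0 < k <= count (<= c) s)%N -> kth_smallest k s <= c.
Proof.
case: k => [//|k] /= ks; rewrite /kth_smallest /=; apply: nth_count_le.
  exact: sort_le_sorted.
by rewrite count_sort.
Qed.

Lemma kth_smallest_gt k s c : (count (<= c) s < k <= size s)%N -> c < kth_smallest k s.
Proof.
case: k => [//|k] /= ks; rewrite /kth_smallest /=; apply: nth_count_gt.
  exact: sort_le_sorted.
by rewrite count_sort size_sort -ltnS.
Qed.
End order_statistic.

(** * Tail bounds for the number of sample points in a set *)

Section sample_counts.
Context (R : realType) (d : nat) (QX : probability 'rV[R]_d R).
Context (dO : measure_display) (Omega : measurableType dO) (Pr : probability Omega R).
Context (Xs : nat -> Omega -> 'rV[R]_d) (Ys : nat -> Omega -> bool).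
Context (Xt : nat -> Omega -> 'rV[R]_d).
Context (mXt : forall j, measurable_fun setT (Xt j)).
Context (XtQ : forall j (A : set 'rV[R]_d), measurable A -> Pr (Xt j @^-1` A) = QX A).
Context (indep : mutually_independent Pr (sample_sigma Xs Ys Xt)).

(** A pattern prescribes for each point either B or its complement, so its event is an intersection
    to which independence applies. *)
Lemma prob_pattern (n : nat) (B : set 'rV[R]_d) (J : {set 'I_n}) : measurable B ->
  prob_atmost Pr [set w | [set i : 'I_n | w \in Xt i @^-1` B]%SET = J]
    (\prod_(i < n) (if i \in J then fine (QX B) else 1 - fine (QX B))).
Proof.
move=> mB.
pose C j := if j \in [seq val i | i <- enum J] then B else ~` B.
have mC j : measurable (C j) by rewrite /C; case: ifP => _ //; exact: measurableC.
(* Independence is stated for both samples jointly, so the events are indexed by [nat + nat], and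
   [s] selects the first n unlabelled points. *)
pose E (k : nat + nat) := if k is inr j then Xt j @^-1` (C j) else setT.
pose s : seq (nat + nat) := [seq inr (val i) | i <- enum 'I_n].
have mE k : measurable (E k).
  case: k => [i|j]; first exact: measurableT.
  by rewrite /E -[X in measurable X]setTI; exact: mXt.
have mI : measurable (\bigcap_(k in [set k | k \in s]) E k).
  apply: fin_bigcap_measurable; first exact: finite_seq.
  by move=> k _; exact: mE.
exists (\bigcap_(k in [set k | k \in s]) E k); split => //.
- move=> w /= wJ k /= /mapP[i _ ->]; rewrite /E /= /C mem_map; last exact: val_inj.
  rewrite mem_enum -wJ inE; case: ifPn; first by rewrite inE.
  by rewrite notin_setE.
- rewrite -[leLHS]fineK ?fin_num_measure// lee_fin.
  rewrite (indep _ E); last 2 first.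
  + rewrite map_inj_uniq ?enum_uniq// => i j [] /val_inj //.
  + by move=> k /mapP[i _ ->]; exists (C i).
  rewrite big_map big_enum /= ler_prod// => i _.
  rewrite fine_ge0//= XtQ// /C mem_map; last exact: val_inj.
  rewrite mem_enum; case: ifP => _ //.
  by rewrite probability_setC// fineB// fin_num_measure.
Qed.

(** An upper tail for arbitrary B is enough: a shortfall of points in a set is an excess in its
    complement. *)
Lemma sample_count_tail (n : nat) (B : set 'rV[R]_d) (eps : R) (a : nat) :
  measurable B -> 0 <= eps <= 2 -> n%:R * (fine (QX B) + eps) <= a%:R ->
  prob_atmost Pr
    [set w | (a <= count (fun x => x \in B) (unlab_sample Xt n w))%N]
    (expR (- (n%:R * eps ^+ 2 / 8))).
Proof.
move=> mB e02 na.
have q01 : 0 <= fine (QX B) <= 1.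
  rewrite fine_ge0//= -lee_fin fineK ?fin_num_measure//.
  exact: probability_le1.
have := @chernoff_count _ _ _ Pr n (fun i => Xt i @^-1` B) (fine (QX B)) eps a
  (fun J => prob_pattern n B J mB) q01 e02 na.
apply: prob_atmost_sub => // w /=.
rewrite /unlab_sample (@count_map_iota _ (fun j => Xt j w)).
by congr (_ <= _)%N; apply: eq_card => i; rewrite !inE.
Qed.

End sample_counts.

(** * Level sets of the regression function *)

Section level_sets.
Context (R : realType) (d : nat) (Q : probability 'rV[R]_d R).
Context (K : set 'rV[R]_d).
Implicit Types (f eta : 'rV[R]_d -> R) (c t u : R).

Lemma compact_measurable_rV : compact K -> measurable K.
Proof.
move=> cK; have : closed K by apply: compact_closed => //; exact: norm_hausdorff.
rewrite -openC => oK; rewrite -[K]setCK; apply: measurableC.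
exact: sub_sigma_algebra.
Qed.

Context (mK : measurable K).

Lemma measurable_sublevel f c : measurable_fun setT f ->
  measurable [set x | K x /\ f x <= c].
Proof.
move=> mf; apply: (measurable_fun_le mK); last exact: measurable_cst.
exact: measurable_funS mf.
Qed.

Lemma measurable_upper_set f c : measurable_fun setT f ->
  measurable (upper_set K f c).
Proof.
move=> mf; apply: (measurable_fun_le mK); first exact: measurable_cst.
exact: measurable_funS mf.
Qed.

Lemma Fcdf_EFin eta c : measurable_fun setT eta ->
  (Fcdf Q K eta c)%:E = Q [set x | K x /\ eta x <= c].
Proof. by move=> meta; rewrite fineK// fin_num_measure//; exact: measurable_sublevel. Qed.

Lemma le_Fcdf eta c1 c2 : measurable_fun setT eta -> c1 <= c2 ->
  Fcdf Q K eta c1 <= Fcdf Q K eta c2.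
Proof.
move=> meta c12; rewrite -lee_fin !Fcdf_EFin//.
apply: le_measure; rewrite ?inE; [exact: measurable_sublevel..|].
by move=> x [Kx xc1]; split => //; exact: le_trans c12.
Qed.

Lemma Fcdf_band eta c1 c2 : measurable_fun setT eta -> c1 <= c2 ->
  Q ([set x | K x /\ eta x <= c2] `\` [set x | K x /\ eta x <= c1]) =
  (Fcdf Q K eta c2 - Fcdf Q K eta c1)%:E.
Proof.
move=> meta c12; have mS c := measurable_sublevel eta c meta.
rewrite measureD ?ltey_eq ?fin_num_measure// EFinB !Fcdf_EFin//.
congr (_ - Q _)%E; apply/seteqP; split => [x []//|x [Kx xc1]].
by do 2!split => //; exact: le_trans c12.
Qed.

(** Sample points outside K escape the sup-norm bound, so they are counted together with the low
    ones; this costs no mass. *)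
Lemma probability_sublevelC eta c : Q (~` K) = 0%E -> measurable_fun setT eta ->
  Q (~` K `|` [set x | K x /\ eta x <= c]) = (Fcdf Q K eta c)%:E.
Proof.
move=> QK meta.
transitivity (Q (~` K) + Q [set x | K x /\ (eta x <= c)%R])%E; last first.
  by rewrite QK add0e Fcdf_EFin.
apply: measureU.
- exact: measurableC.
- exact: measurable_sublevel.
- by apply/seteqP; split => // x [nKx [Kx _]].
Qed.

(* An atom of eta at t would contradict the upper bound as [del -> 0-]. *)
Lemma Fcdf_level eta t alpha (delta0 b2 kappa : R) :
  Q (~` K) = 0%E -> measurable_fun setT eta ->
  Q (upper_set K eta t) = alpha%:E ->
  0 < delta0 -> 0 < b2 -> 0 < kappa ->
  (forall del, `|del| <= delta0 ->
    `|Fcdf Q K eta (t + del) - Fcdf Q K eta t| <= b2 * (`|del| `^ kappa)) ->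
  Fcdf Q K eta t = 1 - alpha.
Proof.
move=> QK meta Qt d0 b20 k0 hB.
have mU := measurable_upper_set eta t meta.
have QKT : Q K = 1%E.
  by have := probability_setC Q (measurableC mK); rewrite setCK QK sube0.
have QL : Q (K `\` upper_set K eta t) = (1 - alpha)%:E.
  have KU : K `&` upper_set K eta t = upper_set K eta t.
    by apply/seteqP; split => [x []//|x []]; split.
  transitivity (Q K - Q (K `&` upper_set K eta t))%E; last by rewrite QKT KU Qt.
  by apply: measureD; rewrite // ltey_eq fin_num_measure.
have mL : measurable (K `\` upper_set K eta t) by exact: measurableD.
apply/eqP; rewrite eq_le; apply/andP; split; last first.
  rewrite -lee_fin -QL Fcdf_EFin//; apply: le_measure; rewrite ?inE//.
    exact: measurable_sublevel.
  move=> x [Kx] /not_andP[//|/negP]; rewrite -ltNge => xt; split => //.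
  exact: ltW.
apply/ler_addgt0Pr => e e0.
(* This u lies in the range of the modulus bound and satisfies b2 u^kappa <= e. The sublevel set at
   t - u misses the upper set at t, so F(t) <= F(t - u) + e <= 1 - alpha + e. *)
pose u := Num.min delta0 ((e / b2) `^ kappa^-1).
have u0 : 0 < u by rewrite /u lt_min d0 powR_gt0// divr_gt0.
have := hB (- u); rewrite normrN (gtr0_norm u0) ge_min lexx => /(_ isT) h.
have hu : b2 * u `^ kappa <= e.
  rewrite mulrC -ler_pdivlMr//.
  apply: (@le_trans _ _ (((e / b2) `^ kappa^-1) `^ kappa)).
    apply: ge0_ler_powR; rewrite ?nnegrE ?powR_ge0 ?(ltW u0) ?(ltW k0)//.
    by rewrite ge_min lexx orbT.
  by rewrite -powRrM mulVf ?gt_eqF// powRr1// divr_ge0// ltW.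
have : Fcdf Q K eta (t - u) <= 1 - alpha.
  rewrite -lee_fin -QL Fcdf_EFin//; apply: le_measure; rewrite ?inE//.
    exact: measurable_sublevel.
  move=> x [Kx xtu]; split => // -[_ tx].
  by have := le_trans tx xtu; rewrite lerBrDr gerDl leNgt u0.
move=> Ftu; rewrite distrC in h.
have h2 := le_trans (ler_norm _) (le_trans h hu).
by rewrite -(subrK (Fcdf Q K eta (t - u)) (Fcdf Q K eta t)) addrC lerD.
Qed.

(** On the symmetric difference, f - th and eta - t have opposite signs. Since f is within del of
    eta and th within s + del of t, eta is within s + 2 del of t. *)
Lemma upper_set_symdiff_band (f eta : 'rV[R]_d -> R) (t th s del : R) :
  (forall x, K x -> `|f x - eta x| < del) -> 0 <= s ->
  t - s - del < th <= t + s + del ->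
  upper_set K f th `+` upper_set K eta t `<=`
    [set x | K x /\ eta x <= t + (s + 2 * del)] `\`
    [set x | K x /\ eta x <= t - (s + 2 * del)].
Proof.
move=> fe s0 /andP[th1 th2] x.
have key : K x -> - del < f x - eta x < del by move=> /fe; rewrite ltr_norml.
case=> -[[Kx hx] /not_andP[//|/negP]]; rewrite -ltNge => hx';
  move: (key Kx) => /andP[k1 k2]; split; (try split => //); (try lra);
  move=> [_]; lra.
Qed.

End level_sets.

(** * Power inequality and the rate sqrt(ln n / n) *)

(** Bounding x + y by twice the larger term treats k <= 1 (subadditivity) and k >= 1 (convexity) at
    once. *)
Lemma powRD_le (R : realType) (x y k : R) : 0 <= x -> 0 <= y -> 0 <= k ->
  (x + y) `^ k <= 2 `^ k * (x `^ k + y `^ k).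
Proof.
move=> x0 y0 k0; wlog xy : x y x0 y0 / x <= y.
  by move=> h; case/orP: (le_total x y) => /h; [|rewrite addrC [X in _ * X]addrC]; exact.
apply: (@le_trans _ _ ((2 * y) `^ k)).
  apply: ge0_ler_powR; rewrite ?nnegrE//; [exact: addr_ge0|exact: mulr_ge0|lra].
by rewrite powRM// ler_wpM2l ?powR_ge0// lerDr powR_ge0.
Qed.

Section rate.
Context (R : realType).

Lemma ln_nat_div_ge0 (n : nat) : 0 <= ln n%:R / n%:R :> R.
Proof.
case: n => [|n]; first by rewrite invr0 mulr0.
by rewrite divr_ge0// ln_ge0// ler1n.
Qed.

(** With n = y^2, ln n = 2 ln y <= 2 y, so ln n / n <= 2 / y, which is at most e^2 once y >= 2 /
    e^2. *)
Lemma sqrt_ln_div_small (e : R) : 0 < e -> exists N : nat, forall n : nat,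
  (N <= n)%N -> (ln n%:R / n%:R) `^ 2^-1 <= e.
Proof.
move=> e0; exists (Num.truncn ((2 / e ^+ 2) ^+ 2)).+1 => n Nn.
have n0 : 0 < n%:R :> R by rewrite ltr0n; exact: leq_trans Nn.
have hn : (2 / e ^+ 2) ^+ 2 <= n%:R.
  by apply: ltW; apply: lt_le_trans (truncnS_gt _) _; rewrite ler_nat.
rewrite powR12_sqrt ?ln_nat_div_ge0//.
set x : R := n%:R in n0 hn *; set y := Num.sqrt x.
have y0 : 0 < y by rewrite sqrtr_gt0.
have xy : x = y ^+ 2 by rewrite sqr_sqrtr// ltW.
have hy : 2 / e ^+ 2 <= y.
  by rewrite -(@ler_pXn2r _ 2)// ?nnegrE -?xy// ltW// divr_gt0// exprn_gt0.
rewrite -[leRHS](ger0_norm (ltW e0)) -sqrtr_sqr ler_wsqrtr//.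
rewrite ler_pdivrMr// xy lnXn// -mulr_natl.
rewrite ler_pdivrMr ?exprn_gt0// in hy.
have lny := ltW (ln_sublinear y0).
have : 2 * y <= (y * e ^+ 2) * y by rewrite ler_wpM2r// ltW.
lra.
Qed.

(** Squared, the claim is 1/n <= ln n, and ln n >= 1 - 1/n >= 1/2 >= 1/n. It serves to absorb the
    rounding of n (1 - alpha). *)
Lemma inv_le_sqrt_ln_div (n : nat) : (2 <= n)%N ->
  n%:R^-1 <= (ln n%:R / n%:R) `^ 2^-1 :> R.
Proof.
move=> n2; rewrite powR12_sqrt ?ln_nat_div_ge0//.
have x2 : 2 <= n%:R :> R by rewrite ler_nat.
set x : R := n%:R in x2 *; have x0 : 0 < x by lra.
rewrite -[leLHS](ger0_norm (_ : 0 <= x^-1)) ?invr_ge0 ?(ltW x0)//.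
rewrite -sqrtr_sqr ler_wsqrtr// expr2 ler_pM2r ?invr_gt0//.
have i2 : x^-1 <= 2^-1 by rewrite lef_pV2 ?posrE.
have := expR_ge1Dx (- ln x); rewrite expRN lnK ?posrE//; lra.
Qed.
End rate.

(** * Bracketing the empirical threshold and the final bound *)

(* The labelled sample enters only through the sup-norm bound [fe]. *)
Lemma t_hat_bracket (R : realType) (d : nat) (K : set 'rV[R]_d)
  (f eta : 'rV[R]_d -> R) (alpha c1 c2 del : R) (xs : seq 'rV[R]_d) :
  (forall x, K x -> `|f x - eta x| < del) ->
  let k := Num.truncn ((size xs)%:R * (1 - alpha)) in
  (0 < k <= size xs)%N ->
  (count (fun x => x \in ~` [set x | K x /\ (eta x <= c2)%R]) xs < (size xs - k).+1)%N ->
  (count (fun x => x \in ~` K `|` [set x | K x /\ (eta x <= c1)%R]) xs < k)%N ->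
  c1 - del < t_hat alpha f xs <= c2 + del.
Proof.
move=> fe k /andP[k0 kn] cnt2 cnt1; apply/andP; split.
  apply: kth_smallest_gt; rewrite size_map kn andbT count_map.
  apply: leq_ltn_trans cnt1; apply: sub_count => x /= fx.
  rewrite inE /=; have [Kx|] := pselect (K x); [right|by left].
  by split => //; have := fe x Kx; rewrite ltr_norml => /andP[]; lra.
apply: kth_smallest_le; rewrite k0/= count_map.
(* At most n - k points lie outside the sublevel set at c2, where n is the size of [xs], so at least
   k lie inside. *)
apply: (@leq_trans (count (fun x => x \in [set x | K x /\ (eta x <= c2)%R]) xs)).
  have := count_predC (fun x => x \in [set x | K x /\ (eta x <= c2)%R]) xs.
  rewrite (_ : count (predC _) xs =
    count (fun x => x \in ~` [set x | K x /\ (eta x <= c2)%R]) xs); last first.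
    by apply: eq_count => x /=; rewrite in_setC.
  by rewrite -/k; move: cnt2 kn; lia.
apply: sub_count => x /=; rewrite inE => -[Kx ex].
by have := fe x Kx; rewrite ltr_norml => /andP[]; lra.
Qed.

(** The factor 8 (r + 1) makes the exponent - 2 (r + 1)^2 ln n, which is at most - (r + 1) ln n. The
    spare factor 1/n <= 1/2 lets two tails share n^-r. *)
Lemma expR_ln_le_half_powR (R : realType) (r eps : R) (n : nat) : 0 < r -> (2 <= n)%N ->
  eps = 8 * (r + 1) * (ln n%:R / n%:R) `^ 2^-1 ->
  expR (- (n%:R * (eps / 2) ^+ 2 / 8)) <= n%:R `^ (- r) / 2.
Proof.
move=> r0 n2 ->; have x2 : 2 <= n%:R :> R by rewrite ler_nat.
rewrite powR12_sqrt ?ln_nat_div_ge0//.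
have -> : n%:R * (8 * (r + 1) * Num.sqrt (ln n%:R / n%:R) / 2) ^+ 2 / 8 =
    2 * (r + 1) ^+ 2 * (n%:R * Num.sqrt (ln n%:R / n%:R) ^+ 2) :> R by field.
rewrite sqr_sqrtr ?ln_nat_div_ge0// [n%:R * _]mulrC divfK; last by lra.
have ln0 : 0 <= ln n%:R :> R by rewrite ln_ge0//; lra.
apply: (@le_trans _ _ (expR (- r * ln n%:R) * expR (- ln n%:R))).
  rewrite -expRD ler_expR.
  have : 0 <= (r + r ^+ 2) * ln n%:R by rewrite mulr_ge0// addr_ge0 ?sqr_ge0// ltW.
  have : 0 <= r ^+ 2 * ln n%:R by rewrite mulr_ge0// sqr_ge0.
  have : 0 <= r * ln n%:R by rewrite mulr_ge0// ltW.
  lra.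
rewrite [X in _ <= X / 2]/powR gt_eqF; last by lra.
rewrite ler_wpM2l ?expR_ge0// expRN lnK ?posrE; last by lra.
by rewrite lef_pV2 ?posrE//; lra.
Qed.

Theorem theorem2 (R : realType) (d : nat) (K : set 'rV[R]_d)
  (PX QX : probability 'rV[R]_d R) (etaP : 'rV[R]_d -> R) (alpha : R)
  (dO : measure_display) (Omega : measurableType dO) (Pr : probability Omega R)
  (Xs : nat -> Omega -> 'rV[R]_d) (Ys : nat -> Omega -> bool)
  (Xt : nat -> Omega -> 'rV[R]_d)
  (est : seq ('rV[R]_d * bool) -> 'rV[R]_d -> R) (delta tau : nat -> R)
  (t delta0 b1 b2 kappa : R) :
  (* the feature space X = K is a compact subset of R^d *)
  compact K ->
  (* P (via its marginal P_X and regression function eta_P) and Q_X live on X *)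
  PX (~` K) = 0%E -> QX (~` K) = 0%E ->
  measurable_fun setT etaP -> (forall x, 0 <= etaP x <= 1) ->
  0 < alpha < 1 ->
  (* the samples: (X_i, Y_i) iid ~ P, X'_j iid ~ Q_X, all independent *)
  (forall i, measurable_fun setT (Xs i)) ->
  (forall i, measurable_fun setT (Ys i)) ->
  (forall j, measurable_fun setT (Xt j)) ->
  (forall i (A : set 'rV[R]_d), measurable A -> Pr (Xs i @^-1` A) = PX A) ->
  (forall i (A : set 'rV[R]_d), measurable A ->
     Pr (Xs i @^-1` A `&` [set w | Ys i w]) = (\int[PX]_(x in A) (etaP x)%:E)%E) ->
  (forall j (A : set 'rV[R]_d), measurable A -> Pr (Xt j @^-1` A) = QX A) ->
  mutually_independent Pr (sample_sigma Xs Ys Xt) ->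
  (* the estimator eta-hat_P, computed from the labelled sample *)
  (forall s, measurable_fun setT (est s)) ->
  (forall m, 0 < delta m) -> (forall m, 0 < tau m) ->
  delta @ \oo --> 0 -> tau @ \oo --> 0 ->
  accurate Pr Xs Ys K etaP est delta tau ->
  (* (A) *)
  0 < t <= 1 -> QX (upper_set K etaP t) = alpha%:E ->
  (* (B) *)
  0 < delta0 -> 0 < b1 -> 0 < b2 -> 0 < kappa ->
  (forall del, `|del| <= delta0 ->
     b1 * (`|del| `^ kappa) <= `|Fcdf QX K etaP (t + del) - Fcdf QX K etaP t|
     <= b2 * (`|del| `^ kappa)) ->
  (* (C) *)
  msupport QX `<=` msupport PX ->
  forall r : R, 0 < r ->
  exists c : R, 0 < c /\
  exists M N : nat, forall m n : nat, (M <= m)%N -> (N <= n)%N ->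
    prob_atleast Pr
      [set w | (QX (upper_set K (est (lab_sample Xs Ys m w))
                      (t_hat alpha (est (lab_sample Xs Ys m w)) (unlab_sample Xt n w))
                    `+` upper_set K etaP t)
               <= (c * (delta m `^ kappa + (ln n%:R / n%:R) `^ (2^-1)))%:E)%E]
      (1 - tau m - n%:R `^ (- r)).
Proof.
move=> cK _ QK meta _ /andP[a0 a1] _ _ mXt _ _ XtQ indep mest delta_gt0 _ delta_cvg _.
move=> [M1 accM] _ Qt d0 b10 b20 k0 hB _ r r0.
have mK := compact_measurable_rV _ _ _ cK.
pose F := Fcdf QX K etaP.
have Ft : F t = 1 - alpha.
  by apply: (Fcdf_level _ _ _ _ mK _ _ _ _ _ _ QK meta Qt d0 b20 k0) => del /hB/andP[].
pose D : R := 2 `^ kappa; have D0 : 0 < D by exact: powR_gt0.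
(* In 2 b2 (s + 2 delta_m)^kappa, splitting the power costs the outer D, s^kappa equals 8 (r + 1) /
   b1 times the rate, and (2 delta_m)^kappa gives the inner D. *)
exists (2 * b2 * D * (8 * (r + 1) / b1 + D)); split.
  by rewrite !mulr_gt0// addr_gt0// divr_gt0// mulr_gt0//; lra.
have [M2 _ hM2] : \forall m \near \oo, `|delta m| <= delta0 / 4.
  by apply: cvgr0_norm_le => //; lra.
(* The first entry forces s <= delta0 / 2, which with delta_m <= delta0 / 4 keeps s + 2 delta_m in
   the range of (B). The second forces eps / 2 <= 2, as the Chernoff bound requires. *)
pose e0 := Num.min (b1 * (delta0 / 2) `^ kappa / (8 * (r + 1))) (4 / (8 * (r + 1))).
have r80 : 0 < 8 * (r + 1) by lra.
have e00 : 0 < e0.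
  by rewrite lt_min !divr_gt0// mulr_gt0// powR_gt0//; lra.
have [N1 hN1] := sqrt_ln_div_small _ _ e00.
(* The last threshold on n gives n (1 - alpha) >= 1, so that the rank k is positive. *)
exists (maxn M1 M2), (maxn (maxn N1 2) (Num.truncn (1 - alpha)^-1).+1) => m n.
rewrite !geq_max => /andP[M1m M2m] /andP[/andP[/hN1 Ln n2] na].
have n0 : 0 < n%:R :> R by rewrite ltr0n; exact: leq_trans n2.
set L := (ln n%:R / n%:R) `^ 2^-1 in Ln *.
pose eps := 8 * (r + 1) * L.
have nL := inv_le_sqrt_ln_div R n n2; rewrite -/L in nL.
have L0 : 0 < L by apply: lt_le_trans nL; rewrite invr_gt0.
have eps0 : 0 < eps by exact: mulr_gt0.
have eps4 : eps <= 4.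
  rewrite /eps mulrC -ler_pdivlMr//; apply: le_trans Ln _.
  by rewrite ge_min lexx orbT.
(* Half of the gap n eps is spent as the Chernoff deviation; the other half is at least 1 and pays
   for rounding n (1 - alpha) down to k. *)
have n_eps : 1 <= n%:R * (eps / 2).
  have h1 : 1 <= n%:R * L by rewrite mulrC -ler_pdivrMr// div1r.
  have : 0 <= (n%:R * L) * r by rewrite mulr_ge0 ?ltW// mulr_gt0.
  rewrite /eps; lra.
pose s := (eps / b1) `^ kappa^-1.
have s0 : 0 < s by rewrite powR_gt0// divr_gt0.
have sk : s `^ kappa = eps / b1.
  by rewrite -powRrM mulVf ?gt_eqF// powRr1// divr_ge0// ltW.
have sd : s <= delta0 / 2.
  rewrite leNgt; apply/negP => /(gt0_ltr_powR k0).
  rewrite !nnegrE (ltW s0) sk => /(_ _ isT); rewrite ltr_pdivlMr//.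
  have : eps <= b1 * (delta0 / 2) `^ kappa.
    rewrite /eps mulrC -ler_pdivlMr//; apply: le_trans Ln _.
    by rewrite ge_min lexx.
  by move=> h1 /(_ ltac:(lra)); rewrite mulrC ltNge h1.
have d4 : delta m <= delta0 / 4 by rewrite -(gtr0_norm (delta_gt0 m)); exact: hM2.
have dm0 := delta_gt0 m.
pose u := s + 2 * delta m.
have u0 : 0 < u by rewrite /u; lra.
have ud : u <= delta0 by rewrite /u; lra.
have mF c := measurable_sublevel _ _ _ mK _ c meta.
have mono c c' := le_Fcdf _ _ QX _ mK _ c c' meta.
have Fs : F (t + s) >= 1 - alpha + eps.
  have /andP[+ _] := hB s ltac:(rewrite gtr0_norm//; lra).
  rewrite (gtr0_norm s0) sk mulrC divfK ?gt_eqF// -/F ger0_norm ?Ft; first by lra.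
  by rewrite subr_ge0 -Ft; apply: mono; lra.
have Fns : F (t - s) <= 1 - alpha - eps.
  have /andP[+ _] := hB (- s) ltac:(rewrite normrN gtr0_norm//; lra).
  rewrite normrN (gtr0_norm s0) sk mulrC divfK ?gt_eqF// -/F distrC ger0_norm ?Ft; first by lra.
  by rewrite subr_ge0 -Ft; apply: mono; lra.
have Fu : F (t + u) - F (t - u) <= 2 * b2 * u `^ kappa.
  have /andP[_ +] := hB u ltac:(rewrite gtr0_norm//; lra).
  have /andP[_ +] := hB (- u) ltac:(rewrite normrN gtr0_norm//; lra).
  rewrite normrN (gtr0_norm u0) -/F distrC => /(le_trans (ler_norm _)) h1 /(le_trans (ler_norm _)) h2.
  lra.
have uk : 2 * b2 * u `^ kappa <=
    2 * b2 * D * (8 * (r + 1) / b1 + D) * (delta m `^ kappa + L).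
  have := powRD_le _ s (2 * delta m) kappa (ltW s0) ltac:(lra) (ltW k0).
  rewrite powRM ?(ltW dm0)// sk -/u -/D => h1.
  rewrite -!mulrA ler_pM2l// ler_pM2l//; apply: le_trans h1 _.
  rewrite ler_pM2l//.
  have h2 : 0 <= D * L by rewrite mulr_ge0// ltW.
  have h3 : 0 <= 8 * (r + 1) / b1 * delta m `^ kappa.
    by rewrite mulr_ge0 ?powR_ge0// divr_ge0// ltW.
  rewrite /eps; lra.
pose k := Num.truncn (n%:R * (1 - alpha)).
have a10 : 0 < 1 - alpha by lra.
have na0 : 0 <= n%:R * (1 - alpha) by rewrite mulr_ge0// ltW.
have k_gt0 : (0 < k)%N.
  rewrite truncn_gt0 -ler_pdivrMr// div1r; apply/ltW/(lt_le_trans (truncnS_gt _)).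
  by rewrite ler_nat.
have k_le : k%:R <= n%:R * (1 - alpha) by rewrite truncn_le.
have kn : (k <= n)%N.
  rewrite -(ler_nat R); apply: le_trans k_le _.
  by rewrite ler_piMr// ltW//; lra.
have k_gt : n%:R * (1 - alpha) < k%:R + 1 by rewrite natr1; exact: truncnS_gt.
(* When the estimator is accurate, the threshold can exceed t + s + delta_m only if more than n - k
   points fall in [B2], and can be at most t - s - delta_m only if at least k fall in [B1]. *)
pose B2 := ~` [set x | K x /\ etaP x <= t + s].
pose B1 := ~` K `|` [set x | K x /\ etaP x <= t - s].
have mB2 : measurable B2 by exact: measurableC.
have mB1 : measurable B1 by apply: measurableU => //; exact: measurableC.
have QB2 : fine (QX B2) = 1 - F (t + s).
  by rewrite probability_setC// fineB// fin_num_measure.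
have QB1 : fine (QX B1) = F (t - s) by rewrite probability_sublevelC.
have eps02 : 0 <= eps / 2 <= 2 by lra.
have nFs := ler_wpM2l (ltW n0) Fs.
have nFns := ler_wpM2l (ltW n0) Fns.
have nalpha : 0 <= n%:R * eps by rewrite mulr_ge0// ltW.
have tail2 := sample_count_tail _ _ _ _ _ _ _ _ _ mXt XtQ indep n B2 (eps / 2)
  (n - k).+1 mB2 eps02 ltac:(rewrite QB2 -[leRHS]natr1 natrB//; lra).
have tail1 := sample_count_tail _ _ _ _ _ _ _ _ _ mXt XtQ indep n B1 (eps / 2)
  k mB1 eps02 ltac:(rewrite QB1; lra).
have half := expR_ln_le_half_powR _ r eps n r0 n2 erefl.
(* Three bad events are removed: an inaccurate estimator, costing tau_m, and the two tails, costing
   n^-r / 2 each. *)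
have := prob_atmost_setC _ _ _ _ _ _
  (prob_atmostU _ _ _ _ _ _ _ _ (accM m M1m) (prob_atmostU _ _ _ _ _ _ _ _ tail2 tail1)).
move=> [E [mE Esub PE]]; exists E; split => //; last first.
  by apply: le_trans PE; rewrite lee_fin; lra.
move=> w /Esub /not_orP[/negP + /not_orP[/negP + /negP]] /=.
rewrite -ltNge -!ltnNge => acc cnt2 cnt1.
set f := est _; set xs := unlab_sample _ _ _ in cnt1 cnt2 *.
have sz : size xs = n by rewrite size_map size_iota.
have fe x : K x -> `|f x - etaP x| < delta m.
  move=> Kx; rewrite -lte_fin; apply: le_lt_trans acc.
  by apply: ereal_sup_ubound; exists x.
have := t_hat_bracket _ _ _ _ _ alpha (t - s) (t + s) _ xs fe.
rewrite sz => /(_ (introT andP (conj k_gt0 kn)) cnt2 cnt1) th.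
have band := upper_set_symdiff_band _ _ _ _ _ _ _ _ _ fe (ltW s0) th.
apply: (@le_trans _ _ (F (t + u) - F (t - u))%:E); last first.
  by rewrite lee_fin; exact: le_trans uk.
rewrite -(Fcdf_band _ _ _ _ mK _ _ _ meta); last by lra.
have mf : measurable_fun setT f by exact: mest.
apply: le_measure; rewrite ?inE//; last exact: measurableD.
by apply: measurableU; apply: measurableD; exact: measurable_upper_set.
Qed.
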